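(* Let $\mathbb{K}$ be a field of characteristic $0$, let $n\geq 1$ be an integer, and let $\mathfrak{H}_n$ be the $(2n+1)$-dimensional Heisenberg Lie algebra over $\mathbb{K}$. Then there is no faithful finite-dimensional linear representation of $\mathfrak{H}_n$ on a $\mathbb{K}$-vector space $V$ with $\dim V\leq n+1$; that is, there is no injective Lie algebra homomorphism $\mathfrak{H}_n\to\mathfrak{gl}(V)$ for such $V$.
   Context: The Heisenberg Lie algebra $\mathfrak{H}_n$ over $\mathbb{K}$ has a basis $X_1,\dots,X_n,Y_1,\dots,Y_n,Z$ whose brackets are $[X_i,Y_j]=\delta_{i,j}Z$, all other brackets of basis elements (except those forced by antisymmetry) being zero. $\mathfrak{gl}(V)$ is $End(V)$ with the commutator bracket. *)

(* Defs.v *)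
From HB Require Import structures.
From mathcomp Require Import all_boot all_order all_algebra.

Set Implicit Arguments.
Unset Strict Implicit.
Unset Printing Implicit Defensive.

Import GRing.Theory.
Local Open Scope ring_scope.

HB.mixin Record isLieAlgebra (K : fieldType) L of GRing.Lmodule K L := {
  lie : L -> L -> L;
  lieDl : forall (a : K) (x y z : L), lie (a *: x + y) z = a *: lie x z + lie y z;
  lieDr : forall (a : K) (x y z : L), lie x (a *: y + z) = a *: lie x y + lie x z;
  liexx : forall x : L, lie x x = 0;
  lie_jacobi : forall x y z : L,
    lie x (lie y z) + lie y (lie z x) + lie z (lie x y) = 0
}.

#[short(type="lieAlgType")]
HB.structure Definition LieAlgebra (K : fieldType) :=
  { L of isLieAlgebra K L & GRing.Lmodule K L }.

Definition lie_morphism (K : fieldType) (L L' : lieAlgType K)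
    (f : {linear L -> L'}) : Prop :=
  forall x y : L, f (lie x y) = lie (f x) (f y).

Section GeneralLinear.
Variables (K : fieldType) (V : vectType K).

(* The parentheses are needed: [\o] and [-] have the same precedence here. *)
Definition gl_bracket (f g : 'End(V)) : 'End(V) := ((f \o g) - (g \o f))%VF.

Fact gl_bracketDl (a : K) (f g h : 'End(V)) :
  gl_bracket (a *: f + g) h = a *: gl_bracket f h + gl_bracket g h.
Proof.
rewrite /gl_bracket comp_lfunDl comp_lfunDr -comp_lfunZl -comp_lfunZr.
by rewrite scalerBr opprD addrACA.
Qed.

Fact gl_bracketxx (f : 'End(V)) : gl_bracket f f = 0.
Proof. by rewrite /gl_bracket subrr. Qed.

Fact gl_bracketC (f g : 'End(V)) : gl_bracket f g = - gl_bracket g f.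
Proof. by rewrite /gl_bracket opprB. Qed.

Fact gl_bracketDr (a : K) (f g h : 'End(V)) :
  gl_bracket f (a *: g + h) = a *: gl_bracket f g + gl_bracket f h.
Proof.
by rewrite gl_bracketC gl_bracketDl opprD -scalerN -!gl_bracketC.
Qed.

Fact gl_bracket_jacobi (f g h : 'End(V)) :
  gl_bracket f (gl_bracket g h) + gl_bracket g (gl_bracket h f) +
  gl_bracket h (gl_bracket f g) = 0.
Proof.
rewrite /gl_bracket !(comp_lfunDl, comp_lfunDr, comp_lfunNl, comp_lfunNr).
rewrite !comp_lfunA.
have E (a b c d : 'End(V)) : a - b - (c - d) = a + d - (b + c).
  by rewrite opprB addrACA -opprD.
rewrite !E [(g \o h \o f + _)%VF]addrC [(h \o f \o g + _)%VF]addrC.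
rewrite [(h \o g \o f + _)%VF]addrC.
move: (f \o g \o h + _)%VF (f \o h \o g + _)%VF (g \o f \o h + _)%VF => p q r.
by rewrite [p - q + _]addrA subrK addrA subrK subrr.
Qed.

(* An alias, so that the commutator bracket is attached to [gl V]. *)
Definition gl : Type := 'End(V).

HB.instance Definition _ := Vector.copy gl 'End(V).

HB.instance Definition _ := @isLieAlgebra.Build K gl gl_bracket
  gl_bracketDl gl_bracketDr gl_bracketxx gl_bracket_jacobi.

Fact lie_glE (f g : gl) (v : V) :
  (lie f g : 'End(V)) v = (f : 'End(V)) ((g : 'End(V)) v) -
                          (g : 'End(V)) ((f : 'End(V)) v).
Proof. by rewrite !lfun_simp. Qed.

End GeneralLinear.

Section Heisenberg.
Variables (K : fieldType) (n : nat).

(* [(x, y, z)] stands for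
   [\sum_i x 0 i *: X_i + \sum_i y 0 i *: Y_i + z *: Z]; see [heis_decomp]. *)
Definition heisenberg : Type := ('rV[K]_n * 'rV[K]_n * K^o)%type.

HB.instance Definition _ :=
  Vector.copy heisenberg ('rV[K]_n * 'rV[K]_n * K^o)%type.

Definition heisX (i : 'I_n) : heisenberg := (delta_mx 0 i, 0, 0).
Definition heisY (i : 'I_n) : heisenberg := (0, delta_mx 0 i, 0).
Definition heisZ : heisenberg := (0, 0, 1).

Definition heis_bracket (u v : heisenberg) : heisenberg :=
  (0, 0, \sum_(i < n) (u.1.1 0 i * v.1.2 0 i - u.1.2 0 i * v.1.1 0 i)).

Fact heis_bracketxx (u : heisenberg) : heis_bracket u u = 0.
Proof.
by congr (_, _, _); apply: big1 => i _; rewrite mulrC subrr.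
Qed.

Fact heis_bracketC (u v : heisenberg) : heis_bracket u v = - heis_bracket v u.
Proof.
congr (_, _, _); rewrite ?oppr0 // -sumrN; apply: eq_bigr => i _.
by rewrite opprB mulrC [in X in _ - X]mulrC.
Qed.

Fact heis_bracketDl (a : K) (u v w : heisenberg) :
  heis_bracket (a *: u + v) w = a *: heis_bracket u w + heis_bracket v w.
Proof.
congr (_, _, _); try by rewrite /= scaler0 addr0.
change (\sum_(i < n) ((a *: u.1.1 + v.1.1) 0 i * w.1.2 0 i -
                      (a *: u.1.2 + v.1.2) 0 i * w.1.1 0 i) =
        a * (\sum_(i < n) (u.1.1 0 i * w.1.2 0 i - u.1.2 0 i * w.1.1 0 i)) +
        \sum_(i < n) (v.1.1 0 i * w.1.2 0 i - v.1.2 0 i * w.1.1 0 i)).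
rewrite mulr_sumr -big_split; apply: eq_bigr => i _ /=.
by rewrite !mxE !mulrDl opprD addrACA -!mulrA -mulrBr.
Qed.

Fact heis_bracketDr (a : K) (u v w : heisenberg) :
  heis_bracket u (a *: v + w) = a *: heis_bracket u v + heis_bracket u w.
Proof.
by rewrite heis_bracketC heis_bracketDl opprD -scalerN -!heis_bracketC.
Qed.

Fact heis_bracket_central (u v w : heisenberg) :
  heis_bracket u (heis_bracket v w) = 0.
Proof.
by congr (_, _, _); apply: big1 => i _; rewrite !mxE !mulr0 subrr.
Qed.

Fact heis_bracket_jacobi (u v w : heisenberg) :
  heis_bracket u (heis_bracket v w) + heis_bracket v (heis_bracket w u) +
  heis_bracket w (heis_bracket u v) = 0.
Proof. by rewrite !heis_bracket_central !addr0. Qed.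

HB.instance Definition _ := @isLieAlgebra.Build K heisenberg heis_bracket
  heis_bracketDl heis_bracketDr heis_bracketxx heis_bracket_jacobi.

Fact heis_decomp (u : heisenberg) :
  u = \sum_i u.1.1 0 i *: heisX i + \sum_i u.1.2 0 i *: heisY i + u.2 *: heisZ.
Proof.
case: u => -[x y] z /=.
have -> : \sum_i x 0 i *: heisX i = (x, 0, 0).
  rewrite {2}[x]row_sum_delta.
  rewrite (@big_morph _ _ (fun w => (w, 0, 0) : heisenberg) 0 +%R 0 +%R) //.
    by apply: eq_bigr => i _; congr (_, _, _); rewrite /= scaler0.
  by move=> w1 w2; congr (_, _, _); rewrite /= addr0.
have -> : \sum_i y 0 i *: heisY i = (0, y, 0).
  rewrite {2}[y]row_sum_delta.
  rewrite (@big_morph _ _ (fun w => (0, w, 0) : heisenberg) 0 +%R 0 +%R) //.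
    by apply: eq_bigr => i _; congr (_, _, _); rewrite /= scaler0.
  by move=> w1 w2; congr (_, _, _); rewrite /= addr0.
congr (_, _, _); rewrite /= ?scaler0 ?addr0 ?add0r //.
by rewrite -[LHS]mulr1.
Qed.

Fact dim_heisenberg : \dim {:heisenberg} = n.*2.+1.
Proof. by rewrite dimvf [LHS]/(1 * n + 1 * n + 1)%N !mul1n plusE addn1 addnn. Qed.

Fact lie_heisXY i j : lie (heisX i) (heisY j) = (i == j)%:R *: heisZ.
Proof.
congr (_, _, _); try by rewrite /= scaler0.
rewrite (bigD1 i) //= big1 => [|k ne_ki].
  rewrite !mxE !eqxx /= mul0r subr0 addr0 mul1r.
  exact: esym (mulr1 _).
by rewrite !mxE !eqxx /= (negPf ne_ki) !mul0r subr0.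
Qed.

Fact lie_heisXX i j : lie (heisX i) (heisX j) = 0.
Proof.
by congr (_, _, _); apply: big1 => k _; rewrite !mxE mulr0 mul0r subrr.
Qed.

Fact lie_heisYY i j : lie (heisY i) (heisY j) = 0.
Proof.
by congr (_, _, _); apply: big1 => k _; rewrite !mxE mulr0 mul0r subrr.
Qed.

Fact lie_heisZ u : lie heisZ u = 0.
Proof.
by congr (_, _, _); apply: big1 => k _; rewrite !mxE !mul0r subrr.
Qed.

End Heisenberg.

(* Main.v *)
From HB Require Import structures.
Require Import Defs.
From mathcomp Require Import all_boot all_order all_algebra.
From mathcomp Require Import zify.

(** Put [Z = rho heisZ] and choose [v] with [Z v != 0].  Since [Z] is a
    commutator that commutes with both factors, a trace computation on its
    eigenspaces shows that it has no nonzero eigenvalue in characteristic [0];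
    hence [Z v] is not a multiple of [v].  Let [A] be the space of all [u] such
    that [rho u v] lies on the line [<[v]>].  Two elements of [A] have [v] as a
    common eigenvector, so their bracket, a multiple of [heisZ], kills [v] and
    therefore vanishes; moreover [heisZ] is not in [A].  So [A] projects
    injectively onto an isotropic subspace of a [2n]-dimensional symplectic
    space, whence [\dim A <= n].  But [A] is the kernel of a map from
    the Heisenberg algebra to [V / <[v]>], so
    [\dim A >= (2 n + 1) - (\dim V - 1)]. *)

Import GRing.Theory passmx.
Local Open Scope ring_scope.

(** [X] and [Y] commute with [Z], so they preserve the eigenspace [E] and restrict to [X'], [Y']
    whose commutator is the scalar matrix [c]. Taking traces gives [0 = c * \rank E]. *)
Lemma commutator_mx_eigenvalue0 {K : fieldType} (charK0 : [pchar K] =i pred0)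
    {m : nat} (X Y Z : 'M[K]_m) (c : K) :
  X *m Y - Y *m X = Z -> comm_mx Z X -> comm_mx Z Y ->
  eigenvalue Z c -> c = 0.
Proof.
move=> defZ cZX cZY /negP nzE; apply/eqP/negP => nz_c; apply: nzE.
rewrite -mxrank_eq0.
set E := eigenspace Z c.
have := row_base_free E; have := eq_row_base E; move: (row_base E) => B eqB freeB.
have stab g : comm_mx Z g -> exists g', B *m g = g' *m B.
  move=> cZg; have sEg := comm_mx_stable_eigenspace c cZg.
  by apply/submxP; rewrite eqB (submx_trans _ sEg) // submxMr // eqB.
have [[X' BX] [Y' BY]] := (stab X cZX, stab Y cZY).
have BZ : B *m Z = c *: B by apply/eigenspaceP; rewrite eqB.
have XY' : X' *m Y' - Y' *m X' = c%:M.
  apply: (row_free_inj freeB); rewrite /= mul_scalar_mx -BZ -defZ.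
  by rewrite mulmxBl mulmxBr -!mulmxA -BX -BY !mulmxA -BX -BY.
have /esym/eqP := congr1 mxtrace XY'.
rewrite linearB /= mxtrace_mulC subrr mxtrace_scalar -mulr_natr mulf_eq0.
by move/pcharf0P: charK0 => ->; case/orP=> // /eqP c0; rewrite c0 eqxx in nz_c.
Qed.

Lemma commutator_eigenvector_ker {K : fieldType} (charK0 : [pchar K] =i pred0)
    {V : vectType K} (f g h : 'End(V)) (c : K) (v : V) :
  (f \o g)%VF - (g \o f)%VF = h -> (h \o f = f \o h)%VF ->
  (h \o g = g \o h)%VF -> h v = c *: v -> h v = 0.
Proof.
move=> defh chf chg hv; have [-> | nz_v] := eqVneq v 0; first exact: linear0.
pose e := vbasis {:V}; have e_basis : basis_of {:V} e := vbasisP _.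
pose M := mxof e e.
have MM (p q : 'End(V)) : M (p \o q)%VF = M q *m M p by apply: mxof_comp.
suff c0 : c = 0 by rewrite hv c0 scale0r.
(* Matrices act on row vectors, so [M] reverses composition: [f] and [g] trade places. *)
apply: (@commutator_mx_eigenvalue0 _ charK0 _ (M g) (M f) (M h)).
- by rewrite -!MM -defh /M linearB.
- by rewrite /comm_mx -!MM chg.
- by rewrite /comm_mx -!MM chf.
apply/eigenvalueP; exists (rVof e v); last by rewrite rVof_eq0.
by rewrite /M -rVof_app // hv linearZ.
Qed.

Lemma heis_lieE (K : fieldType) (n : nat) (u w : heisenberg K n) :
  lie u w =
  (\sum_(i < n) (u.1.1 0 i * w.1.2 0 i - u.1.2 0 i * w.1.1 0 i)) *: heisZ K n.
Proof.
congr (_, _, _); try by rewrite /= scaler0.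
exact: esym (mulr1 _).
Qed.

Lemma heis_centralE (K : fieldType) (n : nat) (u : heisenberg K n) :
  u.1.1 = 0 -> u.1.2 = 0 -> u = u.2 *: heisZ K n.
Proof.
case: u => [[x y] z] /= -> ->.
congr (_, _, _); try by rewrite /= scaler0.
exact: esym (mulr1 _).
Qed.

Lemma heisZ_neq0 (K : fieldType) (n : nat) : heisZ K n != 0.
Proof. by apply/eqP => - [/eqP]; rewrite oner_eq0. Qed.

Lemma dim_heis_isotropic {K : fieldType} {n : nat}
    {U : {vspace heisenberg K n}} :
  heisZ K n \notin U -> {in U &, forall x y, lie x y = 0} ->
  (\dim U <= n)%N.
Proof.
move=> Z'U Uab; set d := \dim U; pose b := vbasis U.
have bU i : b`_i \in U.
  have [lt_id | le_di] := ltnP i d; last by rewrite nth_default ?size_tuple ?mem0v.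
  by rewrite vbasis_mem // mem_nth // size_tuple.
pose X := \matrix_(i < d, j < n) (b`_i).1.1 0 j.
pose Y := \matrix_(i < d, j < n) (b`_i).1.2 0 j.
(* Such a [v] yields a multiple of [heisZ] lying in [U], hence zero; freeness of [b] concludes. *)
have inj_XY (v : 'rV_d) : v *m X = 0 -> v *m Y = 0 -> v = 0.
  move=> vX vY; pose u := \sum_i v 0 i *: b`_i.
  have uU : u \in U by apply: memv_suml => i _; apply: memvZ.
  have u1 : u.1.1 = v *m X.
    rewrite !(raddf_sum fst) /=; apply/rowP => j; rewrite summxE mxE.
    by apply: eq_bigr => i _; rewrite !mxE.
  have u2 : u.1.2 = v *m Y.
    rewrite raddf_sum raddf_sum /=; apply/rowP => j; rewrite summxE mxE.
    by apply: eq_bigr => i _; rewrite !mxE.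
  have uZ : u = u.2 *: heisZ K n by apply: heis_centralE; rewrite ?u1 ?u2.
  have u3 : u.2 = 0.
    apply: contraNeq Z'U => nz_u3.
    by rewrite -[heisZ K n]scale1r -(mulVf nz_u3) -scalerA -uZ memvZ.
  have u0 : u = 0 by rewrite uZ u3 scale0r.
  have /freeP fb := basis_free (vbasisP U).
  by apply/rowP => i; rewrite mxE; apply: (fb (fun i => v 0 i)).
have rM : row_free (row_mx X Y).
  apply: inj_row_free => v; rewrite mul_mx_row -(row_mx0 _ 1 n n).
  by case/eq_row_mx; apply: inj_XY.
have rN : row_free (row_mx Y (- X)).
  apply: inj_row_free => v; rewrite mul_mx_row -(row_mx0 _ 1 n n).
  case/eq_row_mx => vY /eqP; rewrite mulmxN oppr_eq0 => /eqP vX.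
  exact: inj_XY.
(* [(Y | -X)] is [(X | Y)] times the matrix of the symplectic form. *)
have MN0 : row_mx X Y *m (row_mx Y (- X))^T = 0.
  rewrite tr_row_mx mul_row_col; apply/matrixP => i j.
  have := Uab _ _ (bU i) (bU j); rewrite heis_lieE => /eqP.
  rewrite scaler_eq0 (negPf (heisZ_neq0 _ _)) orbF => /eqP sum0.
  rewrite [RHS]mxE -sum0 sumrB !mxE -sumrN; congr (_ + _); apply: eq_bigr => k _;
    by rewrite !mxE ?mulrN.
(* Both factors have rank [d] and the inner dimension is [n + n], so [d + d <= n + n]. *)
have := mulmx0_rank_max MN0; rewrite mxrank_tr (eqP rM) (eqP rN).
by rewrite !addnn leq_double.
Qed.

Theorem theorem3p5 (K : fieldType) (charK0 : [pchar K] =i pred0)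
    (n : nat) (n_gt0 : (1 <= n)%N)
    (V : vectType K) (dimV : (\dim {:V} <= n + 1)%N) :
  ~ exists rho : {linear heisenberg K n -> gl V},
      lie_morphism rho /\ injective rho.
Proof.
case=> rho [rho_lie rho_inj].
pose r u : 'End(V) := rho u; pose Z := heisZ K n.
have r_lie u w : r (lie u w) = (r u \o r w)%VF - (r w \o r u)%VF by apply: rho_lie.
have rZ_comm u : (r Z \o r u = r u \o r Z)%VF.
  by apply/eqP; rewrite -subr_eq0 -r_lie lie_heisZ /r linear0.
have [v nz_rZv] : exists v, r Z v != 0.
  have nz_rZ : r Z != 0.
    apply: contraNneq (heisZ_neq0 K n) => rZ0.
    by apply/eqP/rho_inj; rewrite linear0.
  by have /lfunPn[v] := nz_rZ; rewrite zero_lfunE; exists v.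
have nz_v : v != 0 by apply: contraNneq nz_rZv => ->; rewrite linear0.
have Z_line : r Z v \notin <[v]>%VS.
  (* As [n >= 1], an index [i] exists, and [Z] is the bracket of [heisX K i] and [heisY K i]. *)
  apply: contra nz_rZv => /vlineP[c rZv]; pose i := Ordinal n_gt0.
  apply/eqP/(@commutator_eigenvector_ker _ charK0 V (r (heisX K i)) (r (heisY K i)) _ c).
  - by rewrite -r_lie lie_heisXY eqxx scale1r.
  - exact: rZ_comm.
  - exact: rZ_comm.
  - exact: rZv.
have ev_lin : linear (fun u => r u v).
  by move=> a u w; rewrite /r linearP add_lfunE scale_lfunE.
pose ev : {linear heisenberg K n -> V} :=
  HB.pack (fun u => r u v) (GRing.isLinear.Build _ _ _ _ _ ev_lin).
(* The complement of [<[v]>] stands in for the quotient [V / <[v]>], with [\1 - p] as quotient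
   map. *)
pose p := projv <[v]>; pose q := ((\1 - p) \o linfun ev)%VF; pose A := lker q.
have qE u : q u = r u v - p (r u v).
  by rewrite comp_lfunE add_lfunE opp_lfunE id_lfunE lfunE.
have A_line u : u \in A -> r u v \in <[v]>%VS.
  by rewrite memv_ker qE subr_eq0 => /eqP ->; apply: memv_proj.
have A_ab : {in A &, forall x y, lie x y = 0}.
  move=> x y /A_line /vlineP[a xv] /A_line /vlineP[b yv].
  have : r (lie x y) v = 0.
    rewrite r_lie add_lfunE opp_lfunE !comp_lfunE xv yv !linearZ /=.
    by rewrite xv yv scalerN !scalerA mulrC subrr.
  rewrite heis_lieE; set c := \sum_(i < n) _.
  rewrite /r linearZ /= scale_lfunE => /eqP.
  by rewrite scaler_eq0 (negPf nz_rZv) orbF => /eqP ->; rewrite scale0r.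
have Z'A : Z \notin A by apply: contra Z_line; apply: A_line.
have dimA : (\dim A <= n)%N := dim_heis_isotropic Z'A A_ab.
have := limg_ker_dim q fullv; rewrite capfv dim_heisenberg -/A.
have : (\dim (limg q) <= \dim {:V} - 1)%N.
  have -> : (\dim {:V} - 1)%N = \dim <[v]>^C by rewrite dimv_compl dim_vline nz_v.
  by apply/dimvS/subvP => _ /memv_imgP[u _ ->]; rewrite qE memv_projC.
(* Rank-nullity would give [2 n + 1 <= n + (\dim V - 1) <= 2 n]. *)
lia.
Qed.
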